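(* Let $\mathcal A$ be a pointed regular category and let $F\colon\mathbb A\to\mathbb B$ be a fibration between groupoids in $\mathcal A$. Let $K_F\colon\mathbb K\mathrm{er}(F)\to\mathbb A$ be the kernel of $F$, let $(\mathbb K(F),\ K(F)\colon\mathbb K(F)\to\mathbb A,\ k(F)\colon 0\Rightarrow K(F)\cdot F)$ be the strong h-kernel of $F$ in $\mathbf{Grpd}(\mathcal A)$, and let $J\colon\mathbb K\mathrm{er}(F)\to\mathbb K(F)$ be the canonical comparison, i.e. the unique functor with $J\cdot K(F)=K_F$ and $J\cdot k(F)=\mathrm{id}$. Then $J$ is a weak equivalence. If moreover $F$ is a split epi fibration, then $J$ is an equivalence.
   Context: Composition is written diagrammatically: $f\cdot g$ means first $f$, then $g$. Pointed means having a zero object $0$. **Internal groupoids.** A groupoid $\mathbb B$ in $\mathcal A$ has object of objects $B_0$, object of arrows $B_1$, domain and codomain $d,c\colon B_1\rightrightarrows B_0$, identities $e\colon B_0\to B_1$, composition $m\colon B_1\times_{c,d}B_1\to B_1$ (where $B_1\times_{c,d}B_1$ has projections $\pi_1,\pi_2$ with $\pi_1\cdot c=\pi_2\cdot d$) and inverse $i\colon B_1\to B_1$, satisfying the usual axioms. A functor $F\colon\mathbb A\to\mathbb B$ is a pair $(F_0\colon A_0\to B_0,\ F_1\colon A_1\to B_1)$ compatible with the structure. A natural transformation $\alpha\colon F\Rightarrow G\colon\mathbb A\rightrightarrows\mathbb B$ is an arrow $\alpha\colon A_0\to B_1$ with $\alpha\cdot d=F_0$, $\alpha\cdot c=G_0$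 and $\langle d\cdot\alpha,G_1\rangle\cdot m=\langle F_1,c\cdot\alpha\rangle\cdot m$. These form the 2-category $\mathbf{Grpd}(\mathcal A)$, in which all 2-cells are invertible. Limits in its underlying category, in particular kernels, are level-wise. $[0]$ is the zero groupoid, and $0$ also denotes functors factoring through $[0]$. **Strong h-pullback and strong h-kernel.** A strong h-pullback of $F\colon\mathbb A\to\mathbb B$ and $G\colon\mathbb C\to\mathbb B$ consists of an object $\mathbb P$, 1-cells $G'\colon\mathbb P\to\mathbb A$, $F'\colon\mathbb P\to\mathbb C$ and a 2-cell $\varphi\colon F'\cdot G\Rightarrow G'\cdot F$ such that: (a) for all $H\colon\mathbb X\to\mathbb A$, $K\colon\mathbb X\to\mathbb C$ and $\mu\colon K\cdot G\Rightarrow H\cdot F$ there is a unique $T\colon\mathbb X\to\mathbb P$ with $T\cdot G'=H$, $T\cdot F'=K$, $T\cdot\varphi=\mu$; (b) for all $L,M\colon\mathbb X\rightrightarrows\mathbb P$ and 2-cells $\alpha\colon L\cdot F'\Rightarrow M\cdot F'$, $\beta\colon L\cdot G'\Rightarrow M\cdot G'$ such that ($L\cdot\varphi$ followed by $\beta\cdot F$) equals ($\alpha\cdot G$ followed by $M\cdot\varphi$), there is a unique $\mu\colon L\Rightarrow M$ with $\mu\cdot F'=\alpha$ and $\mu\cdot G'=\beta$. The strong h-kernel of $F$ is the strong h-pullback of $F$ and $0\colon[0]\to\mathbb B$; it exists in $\mathbf{Grpd}(\mathcal A)$. **Classes of functors.** Let $F\colon\mathbb A\to\mathbb B$ be a functor.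 Let $A_0\times_{F_0,d}B_1$ be the pullback of $F_0$ and $d$, with projections $\alpha_d$ to $A_0$ and $\beta_d$ to $B_1$, and let $\tau_d\colon A_1\to A_0\times_{F_0,d}B_1$ be the unique arrow with $\tau_d\cdot\alpha_d=d$ and $\tau_d\cdot\beta_d=F_1$. - $F$ is a fibration (respectively a split epi fibration) if $\tau_d$ is a regular epimorphism (respectively a split epimorphism). - $F$ is fully faithful if $(d,F_1,c)$ exhibits $A_1$ as the limit of $A_0\xrightarrow{F_0}B_0\xleftarrow{d}B_1\xrightarrow{c}B_0\xleftarrow{F_0}A_0$. - $F$ is essentially surjective if $\beta_d\cdot c\colon A_0\times_{F_0,d}B_1\to B_0$ is a regular epimorphism. - $F$ is a weak equivalence if it is fully faithful and essentially surjective. - $F$ is an equivalence if it is an equivalence in the 2-category $\mathbf{Grpd}(\mathcal A)$; equivalently, it is fully faithful and $\beta_d\cdot c$ is a split epimorphism. *)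

(* Defs.v *)
Set Implicit Arguments.
Unset Strict Implicit.

(** Composition is diagrammatic: [f ;; g] is first [f], then [g]. *)

Record category : Type := Category {
  ob :> Type;
  hom : ob -> ob -> Type;
  idm : forall X, hom X X;
  comp : forall X Y Z, hom X Y -> hom Y Z -> hom X Z;
  comp_idl : forall X Y (f : hom X Y), comp (idm X) f = f;
  comp_idr : forall X Y (f : hom X Y), comp f (idm Y) = f;
  comp_assoc : forall W X Y Z (f : hom W X) (g : hom X Y) (h : hom Y Z),
    comp (comp f g) h = comp f (comp g h)
}.

Arguments hom {c} X Y.
Arguments idm {c} X.

Declare Scope cat_scope.
Delimit Scope cat_scope with cat.
Bind Scope cat_scope with hom.
Notation "f ;; g" := (comp f g) (at level 40, left associativity) : cat_scope.
Local Open Scope cat_scope.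

Definition split_epi (C : category) (X Y : C) (f : hom X Y) : Prop :=
  exists s : hom Y X, s ;; f = idm Y.

Definition is_coequalizer (C : category) (R X Q : C)
    (u v : hom R X) (q : hom X Q) : Prop :=
  u ;; q = v ;; q /\
  forall (Y : C) (f : hom X Y), u ;; f = v ;; f ->
    exists! g : hom Q Y, q ;; g = f.

Definition regular_epi (C : category) (X Q : C) (q : hom X Q) : Prop :=
  exists (R : C) (u v : hom R X), is_coequalizer u v q.

Record pullback (C : category) (X Y Z : C) (f : hom X Z) (g : hom Y Z) : Type :=
  Pullback {
    pb_ob :> C;
    pb_fst : hom pb_ob X;
    pb_snd : hom pb_ob Y;
    pb_comm : pb_fst ;; f = pb_snd ;; g;
    pb_pair : forall (W : C) (a : hom W X) (b : hom W Y),
      a ;; f = b ;; g -> hom W pb_ob;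
    pb_pair_fst : forall (W : C) (a : hom W X) (b : hom W Y)
      (H : a ;; f = b ;; g), pb_pair H ;; pb_fst = a;
    pb_pair_snd : forall (W : C) (a : hom W X) (b : hom W Y)
      (H : a ;; f = b ;; g), pb_pair H ;; pb_snd = b;
    pb_pair_uniq : forall (W : C) (a : hom W X) (b : hom W Y)
      (H : a ;; f = b ;; g) (t : hom W pb_ob),
      t ;; pb_fst = a -> t ;; pb_snd = b -> t = pb_pair H
  }.

Record terminal_object (C : category) : Type := TerminalObject {
  terminal_ob :> C;
  to_terminal : forall X : C, hom X terminal_ob;
  to_terminal_uniq : forall (X : C) (f : hom X terminal_ob), f = to_terminal X
}.

Record zero_object (C : category) : Type := ZeroObject {
  zero_ob :> C;
  to_zero : forall X : C, hom X zero_ob;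
  to_zero_uniq : forall (X : C) (f : hom X zero_ob), f = to_zero X;
  from_zero : forall X : C, hom zero_ob X;
  from_zero_uniq : forall (X : C) (f : hom zero_ob X), f = from_zero X
}.

(** Finite limits are given by a terminal object and pullbacks, with a choice
    of the limit objects. *)
Record finlim_category : Type := FinlimCategory {
  fl_cat :> category;
  fl_terminal : terminal_object fl_cat;
  pb : forall (X Y Z : fl_cat) (f : hom X Z) (g : hom Y Z), pullback f g
}.

Definition is_regular (C : finlim_category) : Prop :=
  (forall (X Y : C) (f : hom X Y), exists (Q : C) (q : hom X Q),
     is_coequalizer (pb_fst (pb f f)) (pb_snd (pb f f)) q) /\
  (forall (X Y Z : C) (f : hom X Z) (g : hom Y Z),
     regular_epi g -> regular_epi (pb_fst (pb f g))).

Record groupoid_data (C : finlim_category) : Type := GroupoidData {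
  g0 : C;
  g1 : C;
  gd : hom g1 g0;
  gc : hom g1 g0;
  ge : hom g0 g1;
  gm : hom (pb gc gd) g1;
  gi : hom g1 g1
}.

(** [gmul f g H] is the arrow [<f, g> ;; m], for generalized elements [f], [g]
    of the object of arrows that are composable by [H]. *)
Definition gmul (C : finlim_category) (B : groupoid_data C) (X : C)
    (f g : hom X (g1 B)) (H : f ;; gc B = g ;; gd B) : hom X (g1 B) :=
  pb_pair (pb (gc B) (gd B)) H ;; gm B.

Arguments gmul {C} B {X} f g H.

(** Every composability proof [H] quantified below exists, by the domain and
    codomain axioms.  Associativity is stated on generalized elements; the
    universal ones live on the object of composable triples. *)
Record groupoid (C : finlim_category) : Type := Groupoid {
  g_data :> groupoid_data C;
  g_ed : ge g_data ;; gd g_data = idm _;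
  g_ec : ge g_data ;; gc g_data = idm _;
  g_md : gm g_data ;; gd g_data = pb_fst (pb (gc g_data) (gd g_data)) ;; gd g_data;
  g_mc : gm g_data ;; gc g_data = pb_snd (pb (gc g_data) (gd g_data)) ;; gc g_data;
  g_unitl : forall H, gmul g_data (gd g_data ;; ge g_data) (idm _) H = idm _;
  g_unitr : forall H, gmul g_data (idm _) (gc g_data ;; ge g_data) H = idm _;
  g_assoc : forall (X : C) (f g h : hom X (g1 g_data)) Hfg Hgh Hl Hr,
    gmul g_data (gmul g_data f g Hfg) h Hl = gmul g_data f (gmul g_data g h Hgh) Hr;
  g_id : gi g_data ;; gd g_data = gc g_data;
  g_ic : gi g_data ;; gc g_data = gd g_data;
  g_invr : forall H, gmul g_data (idm _) (gi g_data) H = gd g_data ;; ge g_data;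
  g_invl : forall H, gmul g_data (gi g_data) (idm _) H = gc g_data ;; ge g_data
}.

Record functor (C : finlim_category) (A B : groupoid C) : Type := Functor {
  f0 : hom (g0 A) (g0 B);
  f1 : hom (g1 A) (g1 B);
  f_d : f1 ;; gd B = gd A ;; f0;
  f_c : f1 ;; gc B = gc A ;; f0;
  f_e : ge A ;; f1 = f0 ;; ge B;
  f_m : forall H,
    gm A ;; f1 = gmul B (pb_fst (pb (gc A) (gd A)) ;; f1)
                        (pb_snd (pb (gc A) (gd A)) ;; f1) H;
  f_i : gi A ;; f1 = f1 ;; gi B
}.

Lemma comp_pb_pair (C : category) (X Y Z : C) (f : hom X Z) (g : hom Y Z)
    (P : pullback f g) (V W : C) (t : hom V W) (a : hom W X) (b : hom W Y)
    (H : a ;; f = b ;; g) (H' : t ;; a ;; f = t ;; b ;; g) :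
  t ;; pb_pair P H = pb_pair P H'.
Proof.
  apply pb_pair_uniq; rewrite comp_assoc.
  - now rewrite pb_pair_fst.
  - now rewrite pb_pair_snd.
Qed.

Lemma gmul_ext (C : finlim_category) (B : groupoid_data C) (X : C)
    (f f' g g' : hom X (g1 B)) (H : f ;; gc B = g ;; gd B)
    (H' : f' ;; gc B = g' ;; gd B) :
  f = f' -> g = g' -> gmul B f g H = gmul B f' g' H'.
Proof.
  intros Ef Eg. unfold gmul. f_equal. apply pb_pair_uniq.
  - now rewrite pb_pair_fst.
  - now rewrite pb_pair_snd.
Qed.

Lemma comp_gmul (C : finlim_category) (B : groupoid_data C) (V X : C)
    (t : hom V X) (f g : hom X (g1 B)) (H : f ;; gc B = g ;; gd B)
    (H' : t ;; f ;; gc B = t ;; g ;; gd B) :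
  t ;; gmul B f g H = gmul B (t ;; f) (t ;; g) H'.
Proof.
  unfold gmul. now rewrite <- comp_assoc, (comp_pb_pair _ _ H').
Qed.

Lemma functor_composable (C : finlim_category) (A B : groupoid C)
    (F : functor A B) (X : C) (f g : hom X (g1 A)) :
  f ;; gc A = g ;; gd A -> f ;; f1 F ;; gc B = g ;; f1 F ;; gd B.
Proof.
  intros H.
  now rewrite (comp_assoc f), (comp_assoc g), f_c, f_d, <- !comp_assoc, H.
Qed.

Lemma functor_gmul (C : finlim_category) (A B : groupoid C) (F : functor A B)
    (X : C) (f g : hom X (g1 A)) (H : f ;; gc A = g ;; gd A)
    (H' : f ;; f1 F ;; gc B = g ;; f1 F ;; gd B) :
  gmul A f g H ;; f1 F = gmul B (f ;; f1 F) (g ;; f1 F) H'.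
Proof.
  unfold gmul at 1. rewrite comp_assoc.
  rewrite (f_m (functor_composable F (pb_comm (pb (gc A) (gd A))))).
  unshelve erewrite comp_gmul.
  - rewrite <- (comp_assoc _ _ (f1 F)), <- (comp_assoc _ _ (f1 F)).
    now rewrite pb_pair_fst, pb_pair_snd.
  - apply gmul_ext; rewrite <- comp_assoc.
    + now rewrite pb_pair_fst.
    + now rewrite pb_pair_snd.
Qed.

Definition functor_id (C : finlim_category) (A : groupoid C) : functor A A.
Proof.
  refine {| f0 := idm (g0 A); f1 := idm (g1 A) |}.
  - now rewrite comp_idl, comp_idr.
  - now rewrite comp_idl, comp_idr.
  - now rewrite comp_idl, comp_idr.
  - intros H. rewrite comp_idr. unfold gmul.
    rewrite <- (pb_pair_uniq H (t := idm _)).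
    + now rewrite comp_idl.
    + now rewrite comp_idl, comp_idr.
    + now rewrite comp_idl, comp_idr.
  - now rewrite comp_idl, comp_idr.
Defined.

Definition functor_comp (C : finlim_category) (A B D : groupoid C)
    (F : functor A B) (G : functor B D) : functor A D.
Proof.
  refine {| f0 := f0 F ;; f0 G; f1 := f1 F ;; f1 G |}.
  - now rewrite comp_assoc, f_d, <- comp_assoc, f_d, comp_assoc.
  - now rewrite comp_assoc, f_c, <- comp_assoc, f_c, comp_assoc.
  - now rewrite <- comp_assoc, f_e, comp_assoc, f_e, <- comp_assoc.
  - intros H. rewrite <- comp_assoc.
    pose proof (functor_composable F (pb_comm (pb (gc A) (gd A)))) as HF.
    rewrite (f_m HF), (functor_gmul HF (functor_composable G HF)).
    apply gmul_ext; apply comp_assoc.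
  - now rewrite <- comp_assoc, f_i, comp_assoc, f_i, <- comp_assoc.
Defined.

Notation "F ;;; G" := (functor_comp F G) (at level 40, left associativity) : cat_scope.

(** [f] followed by [g] is defined and equals [f'] followed by [g']. *)
Definition gsquare (C : finlim_category) (B : groupoid_data C) (X : C)
    (f g f' g' : hom X (g1 B)) : Prop :=
  exists (H : f ;; gc B = g ;; gd B) (H' : f' ;; gc B = g' ;; gd B),
    gmul B f g H = gmul B f' g' H'.

(** A 2-cell is an arrow [a] satisfying [is_2cell]; two parallel 2-cells are
    equal exactly when their underlying arrows are.  The whiskerings of [a] with
    functors [L] before and [F] after it are [f0 L ;; a] and [a ;; f1 F]. *)
Definition is_2cell (C : finlim_category) (A B : groupoid C)
    (F G : functor A B) (a : hom (g0 A) (g1 B)) : Prop :=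
  a ;; gd B = f0 F /\
  a ;; gc B = f0 G /\
  gsquare (gd A ;; a) (f1 G) (f1 F) (gc A ;; a).

Definition id_2cell (C : finlim_category) (A B : groupoid C) (F : functor A B) :
    hom (g0 A) (g1 B) :=
  f0 F ;; ge B.

Definition is_invertible_2cell (C : finlim_category) (A B : groupoid C)
    (F G : functor A B) (a : hom (g0 A) (g1 B)) : Prop :=
  is_2cell F G a /\
  exists b, is_2cell G F b /\
    (exists H, gmul B a b H = id_2cell F) /\
    (exists H, gmul B b a H = id_2cell G).

Definition is_equivalence (C : finlim_category) (A B : groupoid C)
    (F : functor A B) : Prop :=
  exists G : functor B A,
    (exists a, is_invertible_2cell (functor_id A) (F ;;; G) a) /\
    (exists b, is_invertible_2cell (G ;;; F) (functor_id B) b).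

Section Zero.
Variables (C : finlim_category) (Z : zero_object C).

Lemma to_zero_eq (X : C) (f g : hom X Z) : f = g.
Proof. now rewrite (to_zero_uniq f), (to_zero_uniq g). Qed.

Lemma from_zero_eq (X : C) (f g : hom Z X) : f = g.
Proof. now rewrite (from_zero_uniq f), (from_zero_uniq g). Qed.

Lemma zero_pb_eq (X : C) (f g : hom (pb (idm (zero_ob Z)) (idm (zero_ob Z))) X) :
  f = g.
Proof.
  set (P := pb (idm (zero_ob Z)) (idm (zero_ob Z))).
  assert (E : idm (pb_ob P) = pb_fst P ;; from_zero Z (pb_ob P)).
  { rewrite (pb_pair_uniq (pb_comm P) (t := idm _)).
    - symmetry; apply pb_pair_uniq; apply to_zero_eq.
    - apply comp_idl.
    - apply comp_idl. }
  rewrite <- (comp_idl f), <- (comp_idl g). fold P. rewrite E, !comp_assoc.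
  f_equal. apply from_zero_eq.
Qed.

Definition zero_groupoid : groupoid C.
Proof.
  refine {| g_data := {| g0 := Z : C; g1 := Z : C; gd := idm _; gc := idm _;
                         ge := idm _; gm := to_zero Z _; gi := idm _ |} |};
  intros; apply to_zero_eq.
Defined.

Definition functor_to_zero (A : groupoid C) : functor A zero_groupoid.
Proof.
  refine {| f0 := to_zero Z (g0 A) : hom _ (g0 zero_groupoid);
            f1 := to_zero Z (g1 A) : hom _ (g1 zero_groupoid) |};
  intros; apply to_zero_eq.
Defined.

Definition functor_from_zero (B : groupoid C) : functor zero_groupoid B.
Proof.
  refine {| f0 := from_zero Z (g0 B) : hom (g0 zero_groupoid) _;
            f1 := from_zero Z (g1 B) : hom (g1 zero_groupoid) _ |};
  intros; try apply from_zero_eq; apply zero_pb_eq.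
Defined.

Definition functor_zero (A B : groupoid C) : functor A B :=
  functor_to_zero A ;;; functor_from_zero B.

Definition is_kernel (A B : groupoid C) (F : functor A B)
    (K : groupoid C) (k : functor K A) : Prop :=
  k ;;; F = functor_zero K B /\
  forall (X : groupoid C) (H : functor X A), H ;;; F = functor_zero X B ->
    exists! T : functor X K, T ;;; k = H.

End Zero.

Definition is_strong_hpullback (C : finlim_category) (A B D : groupoid C)
    (F : functor A B) (G : functor D B)
    (P : groupoid C) (G' : functor P A) (F' : functor P D)
    (phi : hom (g0 P) (g1 B)) : Prop :=
  is_2cell (F' ;;; G) (G' ;;; F) phi /\
  (forall (X : groupoid C) (H : functor X A) (K : functor X D)
      (mu : hom (g0 X) (g1 B)),
    is_2cell (K ;;; G) (H ;;; F) mu ->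
    exists! T : functor X P,
      T ;;; G' = H /\ T ;;; F' = K /\ f0 T ;; phi = mu) /\
  (forall (X : groupoid C) (L M : functor X P)
      (alpha : hom (g0 X) (g1 D)) (beta : hom (g0 X) (g1 A)),
    is_2cell (L ;;; F') (M ;;; F') alpha ->
    is_2cell (L ;;; G') (M ;;; G') beta ->
    gsquare (f0 L ;; phi) (beta ;; f1 F) (alpha ;; f1 G) (f0 M ;; phi) ->
    exists! mu : hom (g0 X) (g1 P),
      is_2cell L M mu /\ mu ;; f1 F' = alpha /\ mu ;; f1 G' = beta).

Definition is_strong_hkernel (C : finlim_category) (Z : zero_object C)
    (A B : groupoid C) (F : functor A B)
    (K : groupoid C) (KF : functor K A) (k : hom (g0 K) (g1 B)) : Prop :=
  is_strong_hpullback F (functor_from_zero Z B) KF (functor_to_zero Z K) k.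

Section Classes.
Variables (C : finlim_category) (A B : groupoid C) (F : functor A B).

Definition tau_d : hom (g1 A) (pb (f0 F) (gd B)) :=
  pb_pair (pb (f0 F) (gd B)) (eq_sym (f_d F)).

Definition is_fibration : Prop := regular_epi tau_d.

Definition is_split_epi_fibration : Prop := split_epi tau_d.

(** [(d, F1, c)] is a limit cone; the legs to the two copies of [g0 B] are
    determined by the others, hence omitted. *)
Definition is_fully_faithful : Prop :=
  forall (X : C) (x : hom X (g0 A)) (b : hom X (g1 B)) (y : hom X (g0 A)),
    x ;; f0 F = b ;; gd B -> b ;; gc B = y ;; f0 F ->
    exists! t : hom X (g1 A), t ;; gd A = x /\ t ;; f1 F = b /\ t ;; gc A = y.

Definition is_essentially_surjective : Prop :=
  regular_epi (pb_snd (pb (f0 F) (gd B)) ;; gc B).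

Definition is_weak_equivalence : Prop :=
  is_fully_faithful /\ is_essentially_surjective.

End Classes.

Definition is_comparison (C : finlim_category) (Z : zero_object C)
    (A B : groupoid C) (Ker K : groupoid C) (KerF : functor Ker A)
    (KF : functor K A) (k : hom (g0 K) (g1 B)) (J : functor Ker K) : Prop :=
  J ;;; KF = KerF /\ f0 J ;; k = id_2cell (functor_zero Z Ker B).

(* Main.v *)
From Stdlib Require Import ProofIrrelevance.
Require Import Defs.

(** An object of the strong h-kernel is an object [a] of [A] with an arrow
    [m : 0 -> F a]; an arrow [(a, m) -> (a', m')] is an arrow [b : a -> a'] of
    [A] with [m . F b = m'].  The comparison [J] sends [x] with [F x = 0] to
    [(x, id)].  All this is read on generalized elements.

    [J] is fully faithful because an arrow [(x, id) -> (y, id)] is an arrow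
    [b : x -> y] with [F b = id], that is, an arrow of the kernel
    ([comparison_fully_faithful]).

    An arrow from some [J x] to [(a, m)] is a lifting of [m] along [F] to an
    arrow with codomain [a].  After inverting, it is a lifting of [m^-1] with
    domain [a], and such liftings are what [tau_d F] parametrizes.  So the map
    whose regular or split epimorphy says that [J] is essentially surjective is,
    up to isomorphism, a pullback of [tau_d F]
    ([comparison_essential_image]), and inherits either property from it.  In
    the split case, a fully faithful functor with split essential surjectivity
    has a quasi-inverse ([equivalence_of_split]).

    Both kernels are known only through their universal properties among
    groupoids, so their generalized elements have to be recovered.  For the
    h-kernel, testing against discrete groupoids suffices: objects
    parametrized by [X] are functors from the discrete groupoid on [X], and
    arrows are 2-cells between these ([hkernel_arrow]).  The universal property of the kernel
    says nothing about 2-cells; instead a kernel computed levelwise is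
    constructed, and every kernel is isomorphic to it ([kernel_levelwise]). *)

Set Implicit Arguments.
Unset Strict Implicit.
Local Open Scope cat_scope.

(** * Arrows and pullbacks *)

Definition mono (C : category) (X Y : C) (f : hom X Y) : Prop :=
  forall (W : C) (x y : hom W X), x ;; f = y ;; f -> x = y.

Lemma pb_ext (C : category) (X Y Z : C) (f : hom X Z) (g : hom Y Z)
    (P : pullback f g) (W : C) (s t : hom W P) :
  s ;; pb_fst P = t ;; pb_fst P -> s ;; pb_snd P = t ;; pb_snd P -> s = t.
Proof.
  intros E1 E2.
  assert (H : t ;; pb_fst P ;; f = t ;; pb_snd P ;; g)
    by now rewrite !comp_assoc, pb_comm.
  rewrite (pb_pair_uniq H E1 E2). symmetry. now apply pb_pair_uniq.
Qed.

(** If [u ;; p] coequalizes [r] and [s], then [p] coequalizes [r ;; u] and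
    [s ;; u], since the epimorphism [u] can be cancelled. *)
Lemma regular_epi_cancel (C : category) (X Y Q : C) (u : hom X Y) (p : hom Y Q) :
  (forall (W : C) (f g : hom Y W), u ;; f = u ;; g -> f = g) ->
  regular_epi (u ;; p) -> regular_epi p.
Proof.
  intros Hu (R & r & s & E & Huniv).
  exists R, (r ;; u), (s ;; u). split.
  - now rewrite !comp_assoc.
  - intros W f Ef.
    destruct (Huniv W (u ;; f)) as (g & Eg & Ug).
    { now rewrite <- !comp_assoc. }
    exists g. split.
    + apply Hu. now rewrite <- comp_assoc.
    + intros g' Eg'. apply Ug. now rewrite comp_assoc, Eg'.
Qed.

(** * Calculating with arrows of an internal groupoid *)

Section Elements.
Variables (C : finlim_category) (B : groupoid C) (X : C).
Implicit Types f g h p q r : hom X (g1 B).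

Lemma gmul_d f g H : gmul B f g H ;; gd B = f ;; gd B.
Proof.
  unfold gmul. now rewrite comp_assoc, g_md, <- comp_assoc, pb_pair_fst.
Qed.

Lemma gmul_c f g H : gmul B f g H ;; gc B = g ;; gc B.
Proof.
  unfold gmul. now rewrite comp_assoc, g_mc, <- comp_assoc, pb_pair_snd.
Qed.

Lemma ge_d (x : hom X (g0 B)) : x ;; ge B ;; gd B = x.
Proof. now rewrite comp_assoc, g_ed, comp_idr. Qed.

Lemma ge_c (x : hom X (g0 B)) : x ;; ge B ;; gc B = x.
Proof. now rewrite comp_assoc, g_ec, comp_idr. Qed.

Lemma gi_d f : f ;; gi B ;; gd B = f ;; gc B.
Proof. now rewrite comp_assoc, g_id. Qed.

Lemma gi_c f : f ;; gi B ;; gc B = f ;; gd B.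
Proof. now rewrite comp_assoc, g_ic. Qed.

Lemma gmul_unitl (x : hom X (g0 B)) f H : gmul B (x ;; ge B) f H = f.
Proof.
  assert (Ex : f ;; gd B = x) by now rewrite <- H, ge_c.
  assert (Hu : gd B ;; ge B ;; gc B = idm _ ;; gd B)
    by now rewrite comp_assoc, g_ec, comp_idl, comp_idr.
  transitivity (f ;; gmul B (gd B ;; ge B) (idm _) Hu).
  - unshelve erewrite comp_gmul.
    + now rewrite !comp_assoc, g_ec, comp_idr, comp_idl.
    + apply gmul_ext.
      * now rewrite <- comp_assoc, Ex.
      * now rewrite comp_idr.
  - now rewrite g_unitl, comp_idr.
Qed.

Lemma gmul_unitr (y : hom X (g0 B)) f H : gmul B f (y ;; ge B) H = f.
Proof.
  assert (Ey : f ;; gc B = y) by now rewrite H, ge_d.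
  assert (Hu : idm _ ;; gc B = gc B ;; ge B ;; gd B)
    by now rewrite comp_assoc, g_ed, comp_idl, comp_idr.
  transitivity (f ;; gmul B (idm _) (gc B ;; ge B) Hu).
  - unshelve erewrite comp_gmul.
    + now rewrite !comp_assoc, g_ed, comp_idr, comp_idl.
    + apply gmul_ext.
      * now rewrite comp_idr.
      * now rewrite <- comp_assoc, Ey.
  - now rewrite g_unitr, comp_idr.
Qed.

Lemma gmul_invr f H : gmul B f (f ;; gi B) H = f ;; gd B ;; ge B.
Proof.
  assert (Hu : idm _ ;; gc B = gi B ;; gd B) by now rewrite g_id, comp_idl.
  rewrite comp_assoc, <- (g_invr Hu).
  unshelve erewrite comp_gmul.
  - now rewrite !comp_assoc, g_id, comp_idl.
  - apply gmul_ext; [now rewrite comp_idr | reflexivity].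
Qed.

Lemma gmul_invl f H : gmul B (f ;; gi B) f H = f ;; gc B ;; ge B.
Proof.
  assert (Hu : gi B ;; gc B = idm _ ;; gd B) by now rewrite g_ic, comp_idl.
  rewrite comp_assoc, <- (g_invl Hu).
  unshelve erewrite comp_gmul.
  - now rewrite !comp_assoc, g_ic, comp_idl.
  - apply gmul_ext; [reflexivity | now rewrite comp_idr].
Qed.

(** Cancellation follows the naming habit for groups: [K] for cancelling a factor
    with its inverse, [V] when the inverse comes first. *)
Lemma gmulK f g H H' : gmul B (gmul B f g H) (g ;; gi B) H' = f.
Proof.
  unshelve erewrite g_assoc.
  - now rewrite gi_d.
  - now rewrite gmul_d.
  - unshelve erewrite (gmul_ext _ (f' := f)); [| | | reflexivity | apply gmul_invr].
    + now rewrite ge_d.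
    + apply gmul_unitr.
Qed.

Lemma gmulVK f g H H' : gmul B (gmul B f (g ;; gi B) H) g H' = f.
Proof.
  unshelve erewrite g_assoc.
  - now rewrite gi_c.
  - now rewrite gmul_d.
  - unshelve erewrite (gmul_ext _ (f' := f)); [| | | reflexivity | apply gmul_invl].
    + now rewrite ge_d, H, gi_d.
    + apply gmul_unitr.
Qed.

Lemma gmulKl f g H H' : gmul B (g ;; gi B) (gmul B g f H) H' = f.
Proof.
  unshelve erewrite <- g_assoc.
  - now rewrite gi_c.
  - now rewrite gmul_c.
  - unshelve erewrite (gmul_ext _ (g' := f)); [| | | apply gmul_invl | reflexivity].
    + now rewrite ge_c, H.
    + apply gmul_unitl.
Qed.

Lemma gmul_cancelr f f' g H H' :
  gmul B f g H = gmul B f' g H' -> f = f'.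
Proof.
  intros E.
  assert (K : forall f H, gmul B f g H ;; gc B = g ;; gi B ;; gd B)
    by (intros; now rewrite gmul_c, gi_d).
  rewrite <- (gmulK (K f H)), <- (gmulK (K f' H')).
  now apply gmul_ext.
Qed.

Lemma gmul_cancell f f' g H H' :
  gmul B g f H = gmul B g f' H' -> f = f'.
Proof.
  intros E.
  assert (K : forall f H, g ;; gi B ;; gc B = gmul B g f H ;; gd B)
    by (intros; now rewrite gmul_d, gi_c).
  rewrite <- (gmulKl (K f H)), <- (gmulKl (K f' H')).
  now apply gmul_ext.
Qed.

Lemma giK f : f ;; gi B ;; gi B = f.
Proof.
  assert (H : f ;; gi B ;; gc B = f ;; gi B ;; gi B ;; gd B) by now rewrite gi_d.
  assert (H' : f ;; gi B ;; gc B = f ;; gd B) by now rewrite gi_c.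
  apply (gmul_cancell (H := H) (H' := H')).
  now rewrite gmul_invr, gmul_invl, gi_d.
Qed.

(** With [p], [q], [r] drawn vertically and [f], [g], [f'], [g'] horizontally,
    this pastes two commutative squares side by side; [gsquare_inv] turns a
    square upside down. *)
Lemma gsquare_paste p f f' q g g' r Hfg Hfg' :
  gsquare p f f' q -> gsquare q g g' r ->
  gsquare p (gmul B f g Hfg) (gmul B f' g' Hfg') r.
Proof.
  intros (H1 & H2 & E1) (H3 & H4 & E2).
  assert (K1 : p ;; gc B = gmul B f g Hfg ;; gd B) by now rewrite gmul_d.
  assert (K2 : gmul B f' g' Hfg' ;; gc B = r ;; gd B) by now rewrite gmul_c.
  assert (K3 : gmul B p f H1 ;; gc B = g ;; gd B) by now rewrite gmul_c.
  assert (K4 : gmul B f' q H2 ;; gc B = g ;; gd B) by now rewrite gmul_c.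
  assert (K5 : f' ;; gc B = gmul B q g H3 ;; gd B) by now rewrite gmul_d.
  assert (K6 : f' ;; gc B = gmul B g' r H4 ;; gd B) by now rewrite gmul_d.
  exists K1, K2.
  rewrite <- (g_assoc K3 K1), (g_assoc K2 K6).
  rewrite (gmul_ext K3 K4 E1 eq_refl), (g_assoc K4 K5).
  now apply gmul_ext.
Qed.

Lemma gsquare_inv p f f' q :
  gsquare p f f' q -> gsquare (p ;; gi B) f' f (q ;; gi B).
Proof.
  intros (H1 & H2 & E).
  assert (D : f ;; gc B = q ;; gc B)
    by now rewrite <- (gmul_c H1), E, gmul_c.
  assert (D' : p ;; gd B = f' ;; gd B)
    by now rewrite <- (gmul_d H1), E, gmul_d.
  assert (K1 : p ;; gi B ;; gc B = f' ;; gd B) by now rewrite gi_c.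
  assert (K2 : f ;; gc B = q ;; gi B ;; gd B) by now rewrite gi_d.
  exists K1, K2.
  assert (K3 : p ;; gc B = gmul B f (q ;; gi B) K2 ;; gd B) by now rewrite gmul_d.
  assert (K4 : gmul B p f H1 ;; gc B = q ;; gi B ;; gd B) by now rewrite gmul_c.
  assert (K5 : gmul B f' q H2 ;; gc B = q ;; gi B ;; gd B)
    by now rewrite gmul_c, gi_d.
  assert (K6 : p ;; gi B ;; gc B = gmul B p (gmul B f (q ;; gi B) K2) K3 ;; gd B)
    by now rewrite gmul_d, gi_c.
  rewrite <- (gmulKl K6).
  apply gmul_ext; [reflexivity |].
  rewrite <- (g_assoc K4 K3), (gmul_ext K4 K5 E eq_refl).
  symmetry. apply gmulK.
Qed.

(** The filler is [p . f . q^-1]: conjugation along the sides [p] and [q]. *)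
Lemma gsquare_fill p f q :
  p ;; gc B = f ;; gd B -> f ;; gc B = q ;; gc B ->
  exists f', f' ;; gd B = p ;; gd B /\ f' ;; gc B = q ;; gd B /\
    gsquare p f f' q.
Proof.
  intros H1 H2.
  assert (K1 : gmul B p f H1 ;; gc B = q ;; gi B ;; gd B)
    by now rewrite gmul_c, gi_d.
  assert (K2 : gmul B (gmul B p f H1) (q ;; gi B) K1 ;; gc B = q ;; gd B)
    by now rewrite gmul_c, gi_c.
  exists (gmul B (gmul B p f H1) (q ;; gi B) K1). repeat split.
  - now rewrite !gmul_d.
  - exact K2.
  - exists H1, K2. symmetry. apply gmulVK.
Qed.

Lemma gsquare_cancelr p f f' f'' q :
  gsquare p f f' q -> gsquare p f f'' q -> f' = f''.
Proof.
  intros (H1 & H2 & E) (H3 & H4 & E').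
  apply (gmul_cancelr (H := H2) (H' := H4)). rewrite <- E, <- E'.
  now apply gmul_ext.
Qed.

Lemma gsquare_comp (W : C) (t : hom W X) f g f' g' :
  gsquare f g f' g' -> gsquare (t ;; f) (t ;; g) (t ;; f') (t ;; g').
Proof.
  intros (H & H' & E).
  assert (K : t ;; f ;; gc B = t ;; g ;; gd B) by now rewrite !comp_assoc, H.
  assert (K' : t ;; f' ;; gc B = t ;; g' ;; gd B) by now rewrite !comp_assoc, H'.
  exists K, K'. now rewrite <- (comp_gmul H), <- (comp_gmul H'), E.
Qed.

End Elements.

(** * Internal functors and natural transformations *)

(** The functor laws are propositions about arrows, so only the two components
    matter, by proof irrelevance. *)
Lemma functor_eq (C : finlim_category) (A B : groupoid C) (F G : functor A B) :
  f0 F = f0 G -> f1 F = f1 G -> F = G.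
Proof.
  destruct F, G; simpl; intros; subst. f_equal; apply proof_irrelevance.
Qed.

Lemma gm_gmul (C : finlim_category) (A : groupoid C) :
  gm A = gmul A (pb_fst _) (pb_snd _) (pb_comm (pb (gc A) (gd A))).
Proof.
  unfold gmul. rewrite <- (pb_pair_uniq (pb_comm _) (t := idm _)).
  - now rewrite comp_idl.
  - apply comp_idl.
  - apply comp_idl.
Qed.

(** Between groupoids, preserving composition forces preservation of identities
    and inverses. *)
Definition multiplicative_functor (C : finlim_category) (A B : groupoid C)
    (F0 : hom (g0 A) (g0 B)) (F1 : hom (g1 A) (g1 B))
    (Hd : F1 ;; gd B = gd A ;; F0) (Hc : F1 ;; gc B = gc A ;; F0)
    (Hm : forall (X : C) (f g : hom X (g1 A)) H H',
      gmul A f g H ;; F1 = gmul B (f ;; F1) (g ;; F1) H') : functor A B.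
Proof.
  assert (K : forall (X : C) (f g : hom X (g1 A)), f ;; gc A = g ;; gd A ->
    f ;; F1 ;; gc B = g ;; F1 ;; gd B).
  { intros X f g H. now rewrite !comp_assoc, Hc, Hd, <- !comp_assoc, H. }
  (* The image of an identity is idempotent, hence an identity. *)
  assert (E : ge A ;; F1 = F0 ;; ge B).
  { assert (H : ge A ;; gc A = ge A ;; gd A) by now rewrite g_ec, g_ed.
    assert (H0 : idm _ ;; ge A ;; gc A = ge A ;; gd A) by now rewrite comp_idl.
    assert (E : gmul A (ge A) (ge A) H = ge A).
    { etransitivity; [| apply (gmul_unitl H0)].
      apply gmul_ext; now rewrite ?comp_idl. }
    assert (H' : ge A ;; F1 ;; gc B = F0 ;; ge B ;; gd B)
      by now rewrite comp_assoc, Hc, <- comp_assoc, g_ec, comp_idl, ge_d.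
    apply (gmul_cancell (g := ge A ;; F1) (H := K _ _ _ H) (H' := H')).
    now rewrite <- (Hm _ _ _ H), E, gmul_unitr. }
  refine {| f0 := F0; f1 := F1; f_d := Hd; f_c := Hc; f_e := E |}.
  - intros H. rewrite gm_gmul. apply Hm.
  - (* Both sides are inverse to [F1] on the right. *)
    assert (H : idm _ ;; gc A = idm _ ;; gi A ;; gd A) by now rewrite gi_d.
    assert (H1 : F1 ;; gc B = gi A ;; F1 ;; gd B)
      by now rewrite comp_assoc, Hd, <- comp_assoc, g_id.
    assert (H2 : F1 ;; gc B = F1 ;; gi B ;; gd B) by now rewrite gi_d.
    apply (gmul_cancell (g := F1) (H := H1) (H' := H2)).
    rewrite gmul_invr, Hd, comp_assoc, <- E, <- comp_assoc.
    rewrite <- (comp_idl (gd A)), <- (gmul_invr H), (Hm _ _ _ H (K _ _ _ H)).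
    apply gmul_ext; now rewrite comp_idl.
Defined.

Lemma fully_faithful_ext (C : finlim_category) (A B : groupoid C)
    (F : functor A B) (X : C) (s t : hom X (g1 A)) :
  is_fully_faithful F ->
  s ;; gd A = t ;; gd A -> s ;; gc A = t ;; gc A -> s ;; f1 F = t ;; f1 F ->
  s = t.
Proof.
  intros HF Ed Ec E1.
  destruct (HF X (t ;; gd A) (t ;; f1 F) (t ;; gc A)) as (u & _ & U).
  - now rewrite !comp_assoc, f_d.
  - now rewrite !comp_assoc, f_c.
  - rewrite <- (U s), <- (U t); auto.
Qed.

Lemma fully_faithful_gsquare (C : finlim_category) (A B : groupoid C)
    (F : functor A B) (X : C) (f g f' g' : hom X (g1 A)) :
  is_fully_faithful F ->
  f ;; gc A = g ;; gd A -> f' ;; gc A = g' ;; gd A ->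
  f ;; gd A = f' ;; gd A -> g ;; gc A = g' ;; gc A ->
  gsquare (f ;; f1 F) (g ;; f1 F) (f' ;; f1 F) (g' ;; f1 F) ->
  gsquare f g f' g'.
Proof.
  intros HF H H' Ed Ec (K & K' & E). exists H, H'.
  apply (fully_faithful_ext HF).
  - now rewrite !gmul_d.
  - now rewrite !gmul_c.
  - now rewrite (functor_gmul H K), (functor_gmul H' K').
Qed.

(** The pointwise inverse is natural: it reverses the naturality square. *)
Lemma invertible_2cell (C : finlim_category) (A B : groupoid C)
    (F G : functor A B) (a : hom (g0 A) (g1 B)) :
  is_2cell F G a -> is_invertible_2cell F G a.
Proof.
  intros (Ed & Ec & N).
  split; [now split |].
  exists (a ;; gi B). repeat split.
  - now rewrite gi_d.
  - now rewrite gi_c.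
  - apply gsquare_inv in N. now rewrite <- !comp_assoc.
  - unshelve eexists; [now rewrite gi_d |].
    now rewrite gmul_invr, Ed.
  - unshelve eexists; [now rewrite gi_c |].
    now rewrite gmul_invl, Ec.
Qed.

(** The splitting chooses, for each object [y] of [B], an object [G0 y] of [A]
    and an arrow [eps : F (G0 y) -> y].  Conjugating an arrow of [B] with [eps]
    gives an arrow [phi] between images of [F], which lifts along [F] to [G1];
    faithfulness makes this a functor.  By construction of [phi], [eps] is a
    natural isomorphism from [G ;;; F] to the identity; the unit is the lift of
    the inverse of [eps] at [F x]. *)
Lemma equivalence_of_split (C : finlim_category) (A B : groupoid C)
    (F : functor A B) :
  is_fully_faithful F -> split_epi (pb_snd (pb (f0 F) (gd B)) ;; gc B) ->
  is_equivalence F.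
Proof.
  intros HF (s & Es).
  set (P := pb (f0 F) (gd B)) in *.
  set (G0 := s ;; pb_fst P). set (eps := s ;; pb_snd P).
  assert (Ed : eps ;; gd B = G0 ;; f0 F)
    by (unfold eps, G0; now rewrite !comp_assoc, pb_comm).
  assert (Ec : eps ;; gc B = idm _) by (unfold eps; now rewrite comp_assoc).
  destruct (gsquare_fill (B := B) (p := gd B ;; eps) (f := idm _)
              (q := gc B ;; eps)) as (phi & phi_d & phi_c & phi_sq).
  { now rewrite comp_assoc, Ec, comp_idl, comp_idr. }
  { now rewrite comp_assoc, Ec, comp_idl, comp_idr. }
  destruct (HF _ (gd B ;; G0) phi (gc B ;; G0)) as (G1 & (G1_d & G1_F & G1_c) & _).
  { now rewrite phi_d, !comp_assoc, Ed. }
  { now rewrite phi_c, !comp_assoc, Ed. }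
  assert (G1_m : forall (X : C) (f g : hom X (g1 B)) H H',
    gmul B f g H ;; G1 = gmul A (f ;; G1) (g ;; G1) H').
  { intros X f g H H'. apply (fully_faithful_ext HF).
    - rewrite gmul_d, !comp_assoc, G1_d, <- !comp_assoc. now rewrite gmul_d.
    - rewrite gmul_c, !comp_assoc, G1_c, <- !comp_assoc. now rewrite gmul_c.
    - rewrite comp_assoc, G1_F.
      rewrite (functor_gmul H' (functor_composable F H')).
      assert (K : f ;; phi ;; gc B = g ;; phi ;; gd B)
        by now rewrite !comp_assoc, phi_c, phi_d, <- !comp_assoc, H.
      transitivity (gmul B (f ;; phi) (g ;; phi) K).
      + (* Both are conjugates of [f . g]: the first by definition, the second
           by pasting the squares of [f] and [g]. *)
        apply (gsquare_cancelr (p := f ;; (gd B ;; eps)) (f := gmul B f g H)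
                 (q := g ;; (gc B ;; eps))).
        * apply (gsquare_comp (gmul B f g H)) in phi_sq.
          now rewrite <- !comp_assoc, gmul_d, gmul_c, !comp_assoc, comp_idr
            in phi_sq.
        * apply gsquare_paste with (q := g ;; (gd B ;; eps)).
          -- apply (gsquare_comp f) in phi_sq.
             rewrite comp_idr, <- (comp_assoc f (gc B)), H, comp_assoc in phi_sq.
             exact phi_sq.
          -- apply (gsquare_comp g) in phi_sq. now rewrite comp_idr in phi_sq.
      + apply gmul_ext; now rewrite comp_assoc, G1_F. }
  set (G := multiplicative_functor G1_d G1_c G1_m).
  exists G. split.
  - destruct (HF _ (idm _) (f0 F ;; eps ;; gi B) (f0 F ;; G0))
      as (eta & (eta_d & eta_F & eta_c) & _).
    { now rewrite gi_d, comp_assoc, Ec, comp_idl, comp_idr. }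
    { now rewrite gi_c, !comp_assoc, Ed. }
    exists eta. apply invertible_2cell. split; [exact eta_d |].
    split; [exact eta_c |]. simpl.
    apply (fully_faithful_gsquare HF).
    + rewrite !comp_assoc, eta_c, G1_d, <- !comp_assoc. now rewrite f_d.
    + now rewrite comp_assoc, eta_d, comp_idl, comp_idr.
    + now rewrite comp_assoc, eta_d, comp_idl, comp_idr.
    + rewrite !comp_assoc, eta_c, G1_c, <- !comp_assoc. now rewrite f_c.
    + apply (gsquare_comp (f1 F)), gsquare_inv in phi_sq.
      rewrite comp_idr, <- !comp_assoc, f_d, f_c in phi_sq.
      rewrite comp_idl, !comp_assoc, eta_F, G1_F, <- !comp_assoc.
      exact phi_sq.
  - exists eps. apply invertible_2cell. split; [exact Ed |].
    split; [exact Ec |]. simpl. now rewrite G1_F.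
Qed.

(** * Discrete groupoids *)

Definition discrete (C : finlim_category) (X : C) : groupoid C.
Proof.
  refine {| g_data := {| g0 := X; g1 := X; gd := idm X; gc := idm X;
    ge := idm X; gm := pb_fst (pb (idm X) (idm X)); gi := idm X |} |}; simpl.
  - apply comp_idl.
  - apply comp_idl.
  - reflexivity.
  - apply pb_comm.
  - intros H. unfold gmul; simpl. now rewrite pb_pair_fst, comp_idl.
  - intros H. unfold gmul; simpl. now rewrite pb_pair_fst.
  - intros W f g h Hfg Hgh Hl Hr. unfold gmul; simpl. now rewrite !pb_pair_fst.
  - apply comp_idl.
  - apply comp_idl.
  - intros H. unfold gmul; simpl. now rewrite pb_pair_fst, comp_idl.
  - intros H. unfold gmul; simpl. now rewrite pb_pair_fst, comp_idl.
Defined.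

Definition discrete_functor (C : finlim_category) (A : groupoid C) (X : C)
    (x : hom X (g0 A)) : functor (discrete X) A.
Proof.
  unshelve refine (@multiplicative_functor C (discrete X) A x (x ;; ge A) _ _ _); simpl.
  - now rewrite ge_d, comp_idl.
  - now rewrite ge_c, comp_idl.
  - intros W f g H H'. unfold gmul at 1; simpl. rewrite pb_pair_fst.
    simpl in H. rewrite !comp_idr in H. subst g. symmetry.
    assert (K : f ;; (x ;; ge A) ;; gc A = f ;; x ;; ge A ;; gd A)
      by now rewrite <- comp_assoc, ge_c, ge_d.
    rewrite (gmul_ext H' K eq_refl (eq_sym (comp_assoc _ _ _))).
    apply gmul_unitr.
Defined.

(** Every naturality square between functors out of a discrete groupoid has
    identities on two opposite sides, so the 2-cells are just the arrows. *)
Lemma discrete_2cell (C : finlim_category) (A : groupoid C) (X : C)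
    (F G : functor (discrete X) A) (b : hom X (g1 A)) :
  b ;; gd A = f0 F -> b ;; gc A = f0 G -> is_2cell F G b.
Proof.
  intros Ed Ec. split; [exact Ed |]. split; [exact Ec |].
  assert (E : forall H : functor (discrete X) A, f1 H = f0 H ;; ge A).
  { intros H. rewrite <- (f_e H). simpl. now rewrite comp_idl. }
  rewrite !E. simpl. rewrite comp_idl.
  unshelve eexists; [now rewrite ge_d |].
  unshelve eexists; [now rewrite ge_c |].
  now rewrite gmul_unitr, gmul_unitl.
Qed.

(** * Zero arrows *)

Definition zero_hom (C : finlim_category) (Z : zero_object C) (X Y : C) : hom X Y :=
  to_zero Z X ;; from_zero Z Y.

Lemma zero_hom_eq (C : finlim_category) (Z : zero_object C) (X Y : C)
    (f : hom X Z) (g : hom Z Y) : f ;; g = zero_hom Z X Y.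
Proof. unfold zero_hom. f_equal; [apply to_zero_uniq | apply from_zero_uniq]. Qed.

Lemma comp_zero_hom (C : finlim_category) (Z : zero_object C) (W X Y : C)
    (f : hom W X) : f ;; zero_hom Z X Y = zero_hom Z W Y.
Proof. unfold zero_hom at 1. rewrite <- comp_assoc. apply zero_hom_eq. Qed.

Lemma zero_hom_comp (C : finlim_category) (Z : zero_object C) (X Y W : C)
    (f : hom Y W) : zero_hom Z X Y ;; f = zero_hom Z X W.
Proof. unfold zero_hom at 1. rewrite comp_assoc. apply zero_hom_eq. Qed.

(** * Strong h-kernels *)

Section HKernel.
Variables (C : finlim_category) (Z : zero_object C).
Variables (A B : groupoid C) (F : functor A B).
Variables (K : groupoid C) (KF : functor K A) (k : hom (g0 K) (g1 B)).
Hypothesis HK : is_strong_hkernel Z F KF k.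

Lemma hkernel_d : k ;; gd B = zero_hom Z (g0 K) (g0 B).
Proof. destruct HK as ((E & _) & _). exact E. Qed.

Lemma hkernel_c : k ;; gc B = f0 KF ;; f0 F.
Proof. destruct HK as ((_ & E & _) & _). exact E. Qed.

(** Naturality of [k], whose domain is the zero functor, so that one side of the
    square is an identity. *)
Lemma hkernel_nat (X : C) (t : hom X (g1 K)) :
  exists H, gmul B (t ;; gd K ;; k) (t ;; f1 KF ;; f1 F) H = t ;; gc K ;; k.
Proof.
  destruct HK as ((_ & _ & N) & _).
  apply (gsquare_comp t) in N. simpl in N. rewrite <- !comp_assoc in N.
  destruct N as (H & H' & E). exists H. rewrite E.
  assert (E0 : t ;; to_zero Z (g1 K) ;; from_zero Z (g1 B)
               = zero_hom Z X (g0 B) ;; ge B)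
    by now rewrite zero_hom_eq, zero_hom_comp.
  assert (H0 : zero_hom Z X (g0 B) ;; ge B ;; gc B = t ;; gc K ;; k ;; gd B)
    by now rewrite <- E0.
  rewrite (gmul_ext H' H0 E0 eq_refl). apply gmul_unitl.
Qed.

(** The 2-dimensional universal property, applied to functors out of the
    discrete groupoid on [X].  On the side of the zero groupoid there is no
    choice of 2-cell, and its image in [B] is an identity. *)
Lemma hkernel_arrow (X : C) (x y : hom X (g0 K)) (b : hom X (g1 A)) :
  b ;; gd A = x ;; f0 KF -> b ;; gc A = y ;; f0 KF ->
  (exists H, gmul B (x ;; k) (b ;; f1 F) H = y ;; k) ->
  exists! t : hom X (g1 K), t ;; gd K = x /\ t ;; gc K = y /\ t ;; f1 KF = b.
Proof.
  intros Ed Ec (H & E).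
  destruct HK as (_ & _ & H2).
  destruct (H2 (discrete X) (discrete_functor x) (discrete_functor y)
              (to_zero Z X : hom X (g1 (zero_groupoid Z))) b)
    as (t & ((Td & Tc & _) & _ & TF) & U).
  - apply discrete_2cell; apply to_zero_eq.
  - now apply discrete_2cell.
  - simpl. exists H.
    assert (E0 : to_zero Z X ;; from_zero Z (g1 B) = zero_hom Z X (g0 B) ;; ge B)
      by now rewrite zero_hom_eq, zero_hom_comp.
    rewrite E0. unshelve eexists.
    + now rewrite ge_c, comp_assoc, hkernel_d, comp_zero_hom.
    + now rewrite gmul_unitl.
  - exists t. split; [auto |].
    intros t' (Td' & Tc' & TF'). apply U. split; [| split].
    + now apply discrete_2cell.
    + apply to_zero_eq.
    + exact TF'.
Qed.

Lemma hkernel_ext (X : C) (s t : hom X (g1 K)) :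
  s ;; gd K = t ;; gd K -> s ;; gc K = t ;; gc K -> s ;; f1 KF = t ;; f1 KF ->
  s = t.
Proof.
  intros Ed Ec E1.
  destruct (@hkernel_arrow X (t ;; gd K) (t ;; gc K) (t ;; f1 KF)) as (u & _ & U).
  - now rewrite !comp_assoc, f_d.
  - now rewrite !comp_assoc, f_c.
  - apply hkernel_nat.
  - rewrite <- (U s), <- (U t); auto.
Qed.

End HKernel.

(** * Kernels *)

(** Monomorphisms into the objects and arrows of [A] whose images are closed under
    the operations carry an internal groupoid; its axioms and the functoriality
    of lifts to it are checked after composing with these monomorphisms. *)
Section Subgroupoid.
Variables (C : finlim_category) (A : groupoid C) (P0 P1 : C).
Variables (k0 : hom P0 (g0 A)) (k1 : hom P1 (g1 A)).
Hypotheses (mono0 : mono k0) (mono1 : mono k1).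
Variables (d c : hom P1 P0) (e : hom P0 P1) (m : hom (pb c d) P1) (i : hom P1 P1).
Hypotheses (Hd : d ;; k0 = k1 ;; gd A) (Hc : c ;; k0 = k1 ;; gc A).
Hypotheses (He : e ;; k1 = k0 ;; ge A) (Hi : i ;; k1 = k1 ;; gi A).
Hypothesis Hm : forall H,
  m ;; k1 = gmul A (pb_fst (pb c d) ;; k1) (pb_snd (pb c d) ;; k1) H.

Let D : groupoid_data C := {| gd := d; gc := c; ge := e; gm := m; gi := i |}.

Lemma subgroupoid_composable (X : C) (f g : hom X P1) :
  f ;; c = g ;; d -> f ;; k1 ;; gc A = g ;; k1 ;; gd A.
Proof.
  intros H. now rewrite !comp_assoc, <- Hc, <- Hd, <- !comp_assoc, H.
Qed.

Lemma subgroupoid_gmul (X : C) (f g : hom X P1) H H' :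
  gmul D f g H ;; k1 = gmul A (f ;; k1) (g ;; k1) H'.
Proof.
  unfold gmul at 1; simpl. rewrite comp_assoc.
  rewrite (Hm (subgroupoid_composable (pb_comm (pb c d)))).
  unshelve erewrite comp_gmul.
  - rewrite <- !(comp_assoc _ _ k1). now rewrite pb_pair_fst, pb_pair_snd.
  - apply gmul_ext; rewrite <- comp_assoc.
    + now rewrite pb_pair_fst.
    + now rewrite pb_pair_snd.
Qed.

Definition subgroupoid : groupoid C.
Proof.
  assert (R : forall (X : C) (f g : hom X P1) H (h : hom X P1),
    (forall H', gmul A (f ;; k1) (g ;; k1) H' = h ;; k1) -> gmul D f g H = h).
  { intros X f g H h E. apply mono1.
    etransitivity; [apply (subgroupoid_gmul H (subgroupoid_composable H)) | apply E]. }
  refine {| g_data := D |}; simpl.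
  - apply mono0. now rewrite comp_assoc, Hd, <- comp_assoc, He, ge_d, comp_idl.
  - apply mono0. now rewrite comp_assoc, Hc, <- comp_assoc, He, ge_c, comp_idl.
  - apply mono0.
    rewrite !comp_assoc, Hd, <- !comp_assoc,
      (Hm (subgroupoid_composable (pb_comm (pb c d)))).
    apply gmul_d.
  - apply mono0.
    rewrite !comp_assoc, Hc, <- !comp_assoc,
      (Hm (subgroupoid_composable (pb_comm (pb c d)))).
    apply gmul_c.
  - intros H. apply R. rewrite comp_idl, (comp_assoc d e), He, <- comp_assoc.
    intros H'. apply gmul_unitl.
  - intros H. apply R. rewrite comp_idl, (comp_assoc c e), He, <- comp_assoc.
    intros H'. apply gmul_unitr.
  - intros X f g h Hfg Hgh Hl Hr. apply R. intros H'.
    etransitivity;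
      [| symmetry; apply (subgroupoid_gmul Hr (subgroupoid_composable Hr))].
    assert (K : gmul A (f ;; k1) (g ;; k1) (subgroupoid_composable Hfg) ;; gc A
                = h ;; k1 ;; gd A)
      by (rewrite gmul_c; now apply subgroupoid_composable).
    assert (K' : f ;; k1 ;; gc A
      = gmul A (g ;; k1) (h ;; k1) (subgroupoid_composable Hgh) ;; gd A)
      by (rewrite gmul_d; now apply subgroupoid_composable).
    transitivity (gmul A _ _ K).
    + apply gmul_ext; [apply subgroupoid_gmul | reflexivity].
    + rewrite (g_assoc K K'). apply gmul_ext; [reflexivity |].
      symmetry. apply subgroupoid_gmul.
  - apply mono0. now rewrite comp_assoc, Hd, <- comp_assoc, Hi, gi_d, Hc.
  - apply mono0. now rewrite comp_assoc, Hc, <- comp_assoc, Hi, gi_c, Hd.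
  - intros H. apply R. rewrite comp_idl, Hi, (comp_assoc d e), He, <- comp_assoc, Hd.
    intros H'. apply gmul_invr.
  - intros H. apply R. rewrite comp_idl, Hi, (comp_assoc c e), He, <- comp_assoc, Hc.
    intros H'. apply gmul_invl.
Defined.

Definition subgroupoid_incl : functor subgroupoid A :=
  @multiplicative_functor C subgroupoid A k0 k1 (eq_sym Hd) (eq_sym Hc)
    subgroupoid_gmul.

Lemma subgroupoid_lift (X : groupoid C) (H : functor X A)
    (h0 : hom (g0 X) P0) (h1 : hom (g1 X) P1) :
  h0 ;; k0 = f0 H -> h1 ;; k1 = f1 H ->
  exists T : functor X subgroupoid, T ;;; subgroupoid_incl = H.
Proof.
  intros E0 E1.
  unshelve eexists.
  - unshelve refine (@multiplicative_functor C X subgroupoid h0 h1 _ _ _); simpl.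
    + apply mono0. now rewrite !comp_assoc, Hd, E0, <- comp_assoc, E1, f_d.
    + apply mono0. now rewrite !comp_assoc, Hc, E0, <- comp_assoc, E1, f_c.
    + intros W f g K K'. apply mono1.
      etransitivity;
        [| symmetry; apply (subgroupoid_gmul K' (subgroupoid_composable K'))].
      rewrite comp_assoc, E1, (functor_gmul K (functor_composable H K)).
      apply gmul_ext; now rewrite comp_assoc, E1.
  - now apply functor_eq.
Qed.

End Subgroupoid.

Section Kernel.
Variables (C : finlim_category) (Z : zero_object C).

Definition kernel_ob (X Y : C) (f : hom X Y) : C := pb f (from_zero Z Y).

Definition ker (X Y : C) (f : hom X Y) : hom (kernel_ob f) X :=
  pb_fst (pb f (from_zero Z Y)).

Lemma ker_lift (X Y W : C) (f : hom X Y) (a : hom W X) :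
  a ;; f = zero_hom Z W Y -> exists u, u ;; ker f = a.
Proof. intros E. exists (pb_pair (pb f (from_zero Z Y)) E). apply pb_pair_fst. Qed.

Lemma ker_mono (X Y : C) (f : hom X Y) : mono (ker f).
Proof.
  intros W x y E. apply pb_ext; [exact E |]. apply to_zero_eq.
Qed.

Lemma ker_zero (X Y : C) (f : hom X Y) : ker f ;; f = zero_hom Z _ Y.
Proof. etransitivity; [apply pb_comm | apply zero_hom_eq]. Qed.

Variables (A B : groupoid C) (F : functor A B).

(** Functors preserve the operations, and the operations send zero arrows to zero
    arrows, so the kernels of [f0 F] and [f1 F] are closed under them. *)
Lemma levelwise_kernel : exists (P : groupoid C) (i : functor P A),
  is_kernel Z F i /\ mono (f0 i) /\ mono (f1 i) /\
  (forall (X : C) (x : hom X (g0 A)), x ;; f0 F = zero_hom Z X (g0 B) ->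
    exists t, t ;; f0 i = x) /\
  (forall (X : C) (b : hom X (g1 A)), b ;; f1 F = zero_hom Z X (g1 B) ->
    exists t, t ;; f1 i = b).
Proof.
  destruct (ker_lift (f := f0 F) (a := ker (f1 F) ;; gd A)) as (d & Hd).
  { rewrite comp_assoc, <- f_d, <- comp_assoc.
    now rewrite ker_zero, zero_hom_comp. }
  destruct (ker_lift (f := f0 F) (a := ker (f1 F) ;; gc A)) as (c & Hc).
  { rewrite comp_assoc, <- f_c, <- comp_assoc.
    now rewrite ker_zero, zero_hom_comp. }
  destruct (ker_lift (f := f1 F) (a := ker (f0 F) ;; ge A)) as (e & He).
  { rewrite comp_assoc, f_e, <- comp_assoc.
    now rewrite ker_zero, zero_hom_comp. }
  destruct (ker_lift (f := f1 F) (a := ker (f1 F) ;; gi A)) as (i & Hi).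
  { rewrite comp_assoc, f_i, <- comp_assoc.
    now rewrite ker_zero, zero_hom_comp. }
  assert (H : pb_fst (pb c d) ;; ker (f1 F) ;; gc A
              = pb_snd (pb c d) ;; ker (f1 F) ;; gd A)
    by (now rewrite !comp_assoc, <- Hc, <- Hd, <- !comp_assoc, pb_comm).
  destruct (ker_lift (f := f1 F) (a := gmul A _ _ H)) as (m & Hm).
  { rewrite (functor_gmul H (functor_composable F H)).
    assert (E : forall t : hom (pb c d) (kernel_ob (f1 F)),
      t ;; ker (f1 F) ;; f1 F = zero_hom Z _ (g0 B) ;; ge B).
    { intros t.
      now rewrite comp_assoc, ker_zero, comp_zero_hom, zero_hom_comp. }
    assert (K : pb_fst (pb c d) ;; ker (f1 F) ;; f1 F ;; gc B
                = zero_hom Z _ (g0 B) ;; ge B ;; gd B)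
      by now rewrite E, ge_c, ge_d.
    rewrite (gmul_ext _ K eq_refl (E _)), gmul_unitr.
    now rewrite E, zero_hom_comp. }
  assert (Hm' : forall H,
    m ;; ker (f1 F)
    = gmul A (pb_fst (pb c d) ;; ker (f1 F)) (pb_snd (pb c d) ;; ker (f1 F)) H).
  { intros H'. rewrite Hm. now apply gmul_ext. }
  pose proof (@ker_mono _ _ (f0 F)) as mono0.
  pose proof (@ker_mono _ _ (f1 F)) as mono1.
  exists (subgroupoid mono0 mono1 Hd Hc He Hi Hm').
  exists (subgroupoid_incl mono0 mono1 Hd Hc He Hi Hm').
  split; [split | split; [| split; [| split]]].
  - apply functor_eq; simpl; apply ker_zero.
  - intros X T E.
    destruct (ker_lift (f := f0 F) (a := f0 T)) as (h0 & E0);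
      [exact (f_equal (@f0 _ _ _) E) |].
    destruct (ker_lift (f := f1 F) (a := f1 T)) as (h1 & E1);
      [exact (f_equal (@f1 _ _ _) E) |].
    destruct (subgroupoid_lift mono0 mono1 Hd Hc He Hi Hm' E0 E1) as (S & ES).
    exists S. split; [exact ES |].
    intros S' ES'. rewrite <- ES' in ES.
    apply functor_eq.
    + apply mono0. exact (f_equal (@f0 _ _ _) ES).
    + apply mono1. exact (f_equal (@f1 _ _ _) ES).
  - exact mono0.
  - exact mono1.
  - intros X x E. now apply ker_lift.
  - intros X b E. now apply ker_lift.
Qed.

Variables (Ker : groupoid C) (KerF : functor Ker A).
Hypothesis HKer : is_kernel Z F KerF.

(** Being a kernel transfers from the levelwise one along the isomorphism [T],
    with inverse [S], given by the two universal properties. *)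
Lemma kernel_levelwise : mono (f0 KerF) /\ mono (f1 KerF) /\
  (forall (X : C) (x : hom X (g0 A)), x ;; f0 F = zero_hom Z X (g0 B) ->
    exists t, t ;; f0 KerF = x) /\
  (forall (X : C) (b : hom X (g1 A)), b ;; f1 F = zero_hom Z X (g1 B) ->
    exists t, t ;; f1 KerF = b).
Proof.
  destruct levelwise_kernel as (P & i & (Ei & Ui) & M0 & M1 & L0 & L1).
  destruct HKer as (EK & UK).
  destruct (UK P i Ei) as (T & ET & _).
  destruct (Ui Ker KerF EK) as (S & ES & _).
  assert (EST : S ;;; T = functor_id Ker).
  { destruct (UK Ker KerF EK) as (I & _ & UI).
    transitivity I; [symmetry |]; apply UI.
    - transitivity (S ;;; (T ;;; KerF)).
      + apply functor_eq; apply comp_assoc.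
      + now rewrite ET.
    - apply functor_eq; apply comp_idl. }
  pose proof (f_equal (@f0 _ _ _) EST) as EST0.
  pose proof (f_equal (@f1 _ _ _) EST) as EST1.
  pose proof (f_equal (@f0 _ _ _) ES) as ES0.
  pose proof (f_equal (@f1 _ _ _) ES) as ES1.
  pose proof (f_equal (@f0 _ _ _) ET) as ET0.
  pose proof (f_equal (@f1 _ _ _) ET) as ET1.
  simpl in *.
  split; [| split; [| split]].
  - intros W x y E.
    rewrite <- (comp_idr x), <- (comp_idr y), <- EST0, <- !comp_assoc. f_equal.
    apply M0. now rewrite !comp_assoc, ES0.
  - intros W x y E.
    rewrite <- (comp_idr x), <- (comp_idr y), <- EST1, <- !comp_assoc. f_equal.
    apply M1. now rewrite !comp_assoc, ES1.
  - intros X x E. destruct (L0 X x E) as (t & Et).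
    exists (t ;; f0 T). now rewrite comp_assoc, ET0.
  - intros X b E. destruct (L1 X b E) as (t & Et).
    exists (t ;; f1 T). now rewrite comp_assoc, ET1.
Qed.

End Kernel.

(** * The comparison *)

Section Comparison.
Variables (C : finlim_category) (Z : zero_object C).
Variables (A B : groupoid C) (F : functor A B).
Variables (Ker : groupoid C) (KerF : functor Ker A).
Hypothesis HKer : is_kernel Z F KerF.
Variables (K : groupoid C) (KF : functor K A) (k : hom (g0 K) (g1 B)).
Hypothesis HK : is_strong_hkernel Z F KF k.

(** [J] is induced by the identity 2-cell of the zero functor [KerF ;;; F]. *)
Lemma comparison_exists : exists J : functor Ker K,
  unique (is_comparison Z KerF KF k) J.
Proof.
  destruct HKer as (EK & _).
  destruct HK as (_ & H1 & _).
  pose (mu := id_2cell (functor_zero Z Ker B)).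
  destruct (H1 Ker KerF (functor_to_zero Z Ker) mu) as (J & (E1 & _ & E3) & U).
  - rewrite EK. unfold mu, id_2cell.
    assert (N : gd Ker ;; (f0 (functor_zero Z Ker B) ;; ge B)
                = gc Ker ;; (f0 (functor_zero Z Ker B) ;; ge B)
              /\ f1 (functor_zero Z Ker B)
                = gd Ker ;; (f0 (functor_zero Z Ker B) ;; ge B)).
    { simpl. now rewrite !zero_hom_eq, !zero_hom_comp, !comp_zero_hom. }
    destruct N as (N1 & N2).
    split; [apply ge_d | split; [apply ge_c |]].
    change (functor_to_zero Z Ker ;;; functor_from_zero Z B)
      with (functor_zero Z Ker B).
    rewrite <- N1, N2.
    assert (H : gd Ker ;; (f0 (functor_zero Z Ker B) ;; ge B) ;; gc B
                = gd Ker ;; (f0 (functor_zero Z Ker B) ;; ge B) ;; gd B)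
      by now rewrite <- !comp_assoc, ge_c, ge_d.
    now exists H, H.
  - exists J. split; [now split |].
    intros J' (E1' & E3'). apply U. split; [exact E1' | split; [| exact E3']].
    apply functor_eq; apply to_zero_eq.
Qed.

Variable J : functor Ker K.
Hypothesis HJ : is_comparison Z KerF KF k J.

Lemma comparison_f0 : f0 J ;; f0 KF = f0 KerF.
Proof. destruct HJ as (E & _). exact (f_equal (@f0 _ _ _) E). Qed.

Lemma comparison_f1 : f1 J ;; f1 KF = f1 KerF.
Proof. destruct HJ as (E & _). exact (f_equal (@f1 _ _ _) E). Qed.

Lemma comparison_zero : f0 J ;; k = zero_hom Z _ _.
Proof.
  destruct HJ as (_ & E). rewrite E. unfold id_2cell; simpl.
  now rewrite zero_hom_eq, zero_hom_comp.
Qed.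

(** An arrow [b] of the h-kernel out of some [J x] satisfies [id . F b = m'], where
    [m'] is the structure arrow of its codomain. *)
Lemma comparison_arrow (X : C) (x : hom X (g0 Ker)) (b : hom X (g1 K)) :
  b ;; gd K = x ;; f0 J -> b ;; f1 KF ;; f1 F = b ;; gc K ;; k.
Proof.
  intros E.
  destruct (hkernel_nat HK b) as (H & <-).
  assert (E0 : b ;; gd K ;; k = zero_hom Z X (g0 B) ;; ge B)
    by now rewrite E, comp_assoc, comparison_zero, comp_zero_hom, zero_hom_comp.
  assert (H0 : zero_hom Z X (g0 B) ;; ge B ;; gc B = b ;; f1 KF ;; f1 F ;; gd B)
    by now rewrite <- E0.
  rewrite (gmul_ext H H0 E0 eq_refl). symmetry. apply gmul_unitl.
Qed.

Lemma comparison_fully_faithful : is_fully_faithful J.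
Proof.
  destruct (kernel_levelwise HKer) as (M0 & M1 & _ & L1).
  intros X x b y Ex Ey.
  destruct (L1 X (b ;; f1 KF)) as (t & Et).
  { rewrite (comparison_arrow (eq_sym Ex)), Ey, comp_assoc, comparison_zero.
    apply comp_zero_hom. }
  assert (Ed : t ;; gd Ker = x).
  { apply M0. rewrite comp_assoc, <- f_d, <- comp_assoc, Et.
    now rewrite comp_assoc, f_d, <- comp_assoc, <- Ex, comp_assoc, comparison_f0. }
  assert (Ec : t ;; gc Ker = y).
  { apply M0. rewrite comp_assoc, <- f_c, <- comp_assoc, Et.
    now rewrite comp_assoc, f_c, <- comp_assoc, Ey, comp_assoc, comparison_f0. }
  exists t. split; [split; [exact Ed | split; [| exact Ec]] |].
  - apply (hkernel_ext HK).
    + now rewrite comp_assoc, f_d, <- comp_assoc, Ed.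
    + now rewrite comp_assoc, f_c, <- comp_assoc, Ec.
    + now rewrite comp_assoc, comparison_f1.
  - intros t' (_ & E & _). apply M1.
    now rewrite Et, <- E, comp_assoc, comparison_f1.
Qed.

Let P := pb (f0 J) (gd K).

(** At an object [(a, m)] of the h-kernel, [h] is the lifting problem [(a, m^-1)]
    for [F], and the pullback of [tau_d F] along [h] parametrizes its solutions
    [g : a -> x].  Then [F x = 0], and the inverse of [g] is an arrow
    [J x -> (a, m)]; this is [u].  Conversely [v] inverts such an arrow. *)
Lemma comparison_essential_image :
  exists (h : hom (g0 K) (pb (f0 F) (gd B)))
    (u : hom (pb h (tau_d F)) P) (v : hom P (pb h (tau_d F))),
    v ;; u = idm _ /\ u ;; (pb_snd P ;; gc K) = pb_fst (pb h (tau_d F)).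
Proof.
  destruct (kernel_levelwise HKer) as (M0 & _ & L0 & _).
  assert (Hh : f0 KF ;; f0 F = k ;; gi B ;; gd B) by now rewrite gi_d, (hkernel_c HK).
  set (h := pb_pair (pb (f0 F) (gd B)) Hh).
  assert (h1 : h ;; pb_fst _ = f0 KF) by apply pb_pair_fst.
  assert (h2 : h ;; pb_snd _ = k ;; gi B) by apply pb_pair_snd.
  assert (t1 : tau_d F ;; pb_fst _ = gd A) by apply pb_pair_fst.
  assert (t2 : tau_d F ;; pb_snd _ = f1 F) by apply pb_pair_snd.
  set (Q := pb h (tau_d F)).
  set (y := pb_fst Q). set (g := pb_snd Q).
  assert (Eg_d : g ;; gd A = y ;; f0 KF)
    by (rewrite <- t1, <- h1, <- !comp_assoc; unfold g, y; now rewrite pb_comm).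
  assert (Eg_F : g ;; f1 F = y ;; k ;; gi B)
    by (rewrite <- t2, (comp_assoc y), <- h2, <- !comp_assoc; unfold g, y;
        now rewrite pb_comm).
  destruct (L0 _ (g ;; gc A)) as (x & Ex).
  { rewrite comp_assoc, <- f_c, <- comp_assoc, Eg_F, gi_c, comp_assoc.
    now rewrite (hkernel_d HK), comp_zero_hom. }
  destruct (hkernel_arrow HK (x := x ;; f0 J) (y := y) (b := g ;; gi A))
    as (b & (b_d & b_c & b_F) & _).
  { now rewrite gi_d, comp_assoc, comparison_f0. }
  { now rewrite gi_c. }
  { assert (E0 : x ;; f0 J ;; k = zero_hom Z _ (g0 B) ;; ge B)
      by now rewrite comp_assoc, comparison_zero, comp_zero_hom, zero_hom_comp.
    assert (E1 : g ;; gi A ;; f1 F = y ;; k).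
    { now rewrite comp_assoc, f_i, <- comp_assoc, Eg_F, giK. }
    rewrite E0, E1.
    unshelve eexists.
    - now rewrite ge_c, comp_assoc, (hkernel_d HK), comp_zero_hom.
    - apply gmul_unitl. }
  exists h. fold Q. exists (pb_pair P (eq_sym b_d)).
  assert (Hv : pb_snd P ;; gc K ;; h = pb_snd P ;; f1 KF ;; gi A ;; tau_d F).
  { apply pb_ext; rewrite !comp_assoc.
    - now rewrite h1, t1, g_id, f_c.
    - rewrite h2, t2, f_i, <- !comp_assoc. f_equal. symmetry.
      exact (comparison_arrow (eq_sym (pb_comm P))). }
  exists (pb_pair Q Hv). split.
  - assert (Ev1 : pb_pair Q Hv ;; y = pb_snd P ;; gc K) by apply pb_pair_fst.
    assert (Ev2 : pb_pair Q Hv ;; g = pb_snd P ;; f1 KF ;; gi A)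
      by apply pb_pair_snd.
    assert (Ex' : pb_pair Q Hv ;; x = pb_fst P).
    { apply M0. rewrite comp_assoc, Ex, <- comp_assoc, Ev2, gi_c.
      rewrite comp_assoc, f_d, <- comp_assoc, <- pb_comm, comp_assoc.
      now rewrite comparison_f0. }
    apply pb_ext; rewrite comp_idl, comp_assoc, ?pb_pair_fst, ?pb_pair_snd.
    + exact Ex'.
    + apply (hkernel_ext HK).
      * now rewrite comp_assoc, b_d, <- comp_assoc, Ex', pb_comm.
      * now rewrite comp_assoc, b_c.
      * rewrite comp_assoc, b_F, <- comp_assoc, Ev2.
        apply giK.
  - now rewrite <- comp_assoc, pb_pair_snd, b_c.
Qed.

(** The comparison map with the pullback of [tau_d F] is a split epimorphism, which
    is enough to transfer regular epimorphy. *)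
Lemma comparison_essentially_surjective :
  is_regular C -> is_fibration F -> is_essentially_surjective J.
Proof.
  intros (_ & R) HF.
  destruct comparison_essential_image as (h & u & v & E & Eu).
  apply (regular_epi_cancel (u := u)).
  - intros W f g Efg.
    now rewrite <- (comp_idl f), <- (comp_idl g), <- E, !comp_assoc, Efg.
  - fold P. rewrite Eu. now apply R.
Qed.

Lemma comparison_split :
  is_split_epi_fibration F -> split_epi (pb_snd P ;; gc K).
Proof.
  intros (s & Es).
  destruct comparison_essential_image as (h & u & _ & _ & Eu).
  assert (H : idm _ ;; h = h ;; s ;; tau_d F)
    by now rewrite comp_assoc, Es, comp_idl, comp_idr.
  exists (pb_pair (pb h (tau_d F)) H ;; u).
  now rewrite comp_assoc, Eu, pb_pair_fst.
Qed.

End Comparison.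

Theorem corollary4p6 :
  forall (C : finlim_category) (Z : zero_object C),
  is_regular C ->
  forall (A B : groupoid C) (F : functor A B),
  is_fibration F ->
  forall (Ker : groupoid C) (KerF : functor Ker A),
  is_kernel Z F KerF ->
  forall (K : groupoid C) (KF : functor K A) (k : hom (g0 K) (g1 B)),
  is_strong_hkernel Z F KF k ->
  exists J : functor Ker K,
    unique (is_comparison Z KerF KF k) J /\
    is_weak_equivalence J /\
    (is_split_epi_fibration F -> is_equivalence J).
Proof.
  intros C Z HC A B F HF Ker KerF HKer K KF k HK.
  destruct (comparison_exists HKer HK) as (J & HJ).
  exists J. split; [exact HJ |].
  destruct HJ as (HJ & _).
  pose proof (comparison_fully_faithful HKer HK HJ) as FF.
  split.
  - split; [exact FF |].
    exact (comparison_essentially_surjective HKer HK HJ HC HF).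
  - intros HS. apply (equivalence_of_split FF).
    exact (comparison_split HKer HK HJ HS).
Qed.
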